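(* Let $1\le k\le r$. We have the following reduced expression of $\varpi_k$ in the Coxeter group $W_\tau$: $$\varpi_k=(\mathbf r_0\mathbf r_1\cdots\mathbf r_{r-1}\mathbf r_r\mathbf r_{r-1}\cdots\mathbf r_k)^k;$$ and in addition $\varpi_{r-1}=(\mathbf r_0\mathbf r_1\cdots\mathbf r_r)^{r-1}\mathbf r_1\mathbf r_2\cdots\mathbf r_{r-1}$ is a reduced expression. In particular, the length of $\varpi_k$ in $W_\tau$ is $k(2r+1-k)$.
   Context: Fix an integer $r\ge1$. Let $\mathbb I=\{0,1,\dots,2r\}$, $\mathbb I_0=\{1,\dots,2r\}$, and let $(c_{ij})_{i,j\in\mathbb I}$ be the affine Cartan matrix of type $A^{(1)}_{2r}$: $c_{ii}=2$, $c_{ij}=-1$ if $i-j\equiv\pm1\pmod{2r+1}$, $c_{ij}=0$ otherwise. Let $\tau$ be the involution of $\mathbb I$ with $\tau0=0$, $\tau i=2r+1-i$ for $i\in\mathbb I_0$. Let $W=\langle s_i\mid i\in\mathbb I\rangle$ be the affine Weyl group acting on $\bigoplus_{i\in\mathbb I}\mathbb Z\alpha_i$ by $s_i\alpha_j=\alpha_j-c_{ij}\alpha_i$, and $\delta=\sum_{i\in\mathbb I}\alpha_i$. The group $W_\tau=\{w\in W\mid\tau w=w\tau\}$ ($\tau$ acting by $\tau s_i=s_{\tau i}\tau$) is a Coxeter group with Coxeter generators $\mathbf r_0=s_0$, $\mathbf r_i=s_is_{\tau i}$ ($1\le i\le r-1$), $\mathbf r_r=s_rs_{r+1}s_r$;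 reducedness and length in $W_\tau$ are with respect to these generators. With $\omega_i$ ($i\in\mathbb I_0$) the fundamental weights of $\mathfrak{sl}_{2r+1}$ and $t_\omega$ the translation in the extended affine Weyl group, $t_\omega(\alpha_j)=\alpha_j-\langle\omega,\alpha_j\rangle\delta$ for $j\in\mathbb I_0$ (where $\langle\omega_i,\alpha_j\rangle=\delta_{ij}$), put $\varpi_i=t_{\omega_i}t_{\omega_{\tau i}}$ for $i\in\mathbb I_0$; this lies in $W_\tau$. By convention $\varpi_0=1$ (relevant only for the second formula when $r=1$). *)

(* Defs.v *)
From HB Require Import structures.
From mathcomp Require Import all_boot all_order all_algebra.
From mathcomp Require Import ring zify.

Set Implicit Arguments.
Unset Strict Implicit.
Unset Printing Implicit Defensive.

Import Order.TTheory GRing.Theory Num.Theory.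
Local Open Scope ring_scope.

Notation node r := 'I_(r.*2.+1).
Notation lattice r := 'cV[int]_(r.*2.+1).
(* Endomorphisms act on columns from the left, so that the product g * h is
   the composite "h first, then g". *)
Notation endo r := 'M[int]_(r.*2.+1).

Definition cartan r (i j : node r) : int :=
  if i == j then 2
  else if (i == j.+1 %[mod r.*2.+1])%N || (j == i.+1 %[mod r.*2.+1])%N then -1
  else 0.

Definition tau r (i : node r) : node r :=
  if i == 0 then 0 else inord (r.*2.+1 - i).

Definition alpha r (i : node r) : lattice r := delta_mx i 0.

Definition delta r : lattice r := \sum_(i < r.*2.+1) alpha i.

(* The endomorphism with alpha j |-> f j. *)
Definition linmap r (f : node r -> lattice r) : endo r :=
  \matrix_(i, j) f j i 0.

(* The affine Weyl group and the extended affine Weyl group act faithfully on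
   the root lattice; they are identified with groups of endomorphisms of it. *)
Definition refl r (i : node r) : endo r :=
  linmap (fun j => alpha j - cartan i j *: alpha i).

Definition tauM r : endo r := linmap (fun j : node r => alpha (tau j)).

(* The simple reflections are involutions, so words in them exhaust the
   group that they generate. *)
Definition inW r (w : endo r) : Prop :=
  exists u : seq (node r), w = \prod_(i <- u) refl i.

Definition inWtau r (w : endo r) : Prop :=
  inW w /\ tauM r * w = w * tauM r.

Definition rgen r (i : 'I_r.+1) : endo r :=
  if i == 0 :> nat then refl 0
  else if i == r :> nat
       then refl (inord r) * refl (inord r.+1) * refl (inord r)
       else refl (inord i) * refl (tau (inord i)).

Definition evalw r (u : seq 'I_r.+1) : endo r := \prod_(i <- u) rgen i.

Definition has_length r (w : endo r) (l : nat) : Prop :=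
  [/\ inWtau w,
      exists2 u : seq 'I_r.+1, evalw u = w & size u = l
    & forall u : seq 'I_r.+1, evalw u = w -> (l <= size u)%N].

Definition reduced_expression r (u : seq 'I_r.+1) (w : endo r) : Prop :=
  w = evalw u /\ has_length w (size u).

(* A weight of sl_(2r+1) is given by its pairings with the alpha j; it is
   extended to alpha 0 = delta - \sum_(j != 0) alpha j so as to vanish on delta.
   For i = 0 the formula below gives the zero weight. *)
Definition fund_weight r (i : node r) : 'rV[int]_(r.*2.+1) :=
  \row_j ((j == i)%:R - (j == 0)%:R).

Definition pairing r (w : 'rV[int]_(r.*2.+1)) (v : lattice r) : int :=
  (w *m v) 0 0.

Definition transl r (w : 'rV[int]_(r.*2.+1)) : endo r :=
  linmap (fun j => alpha j - pairing w (alpha j) *: delta r).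

Definition varpi r (i : node r) : endo r :=
  transl (fund_weight i) * transl (fund_weight (tau i)).

Lemma linmap_alpha r (f : node r -> lattice r) j : linmap f *m alpha j = f j.
Proof. by rewrite -colE; apply/colP=> i; rewrite !mxE. Qed.

Lemma refl_alpha r (i j : node r) :
  refl i *m alpha j = alpha j - cartan i j *: alpha i.
Proof. exact: linmap_alpha. Qed.

Lemma tauM_alpha r (j : node r) : tauM r *m alpha j = alpha (tau j).
Proof. exact: linmap_alpha. Qed.

Lemma val_tau r (i : node r) :
  tau i = (if i == 0 :> nat then 0 else r.*2.+1 - i)%N :> nat.
Proof.
rewrite /tau -(inj_eq val_inj) /=; case: ifP => //= /negbT i0.
by rewrite inordK //; lia.
Qed.

Lemma tauK r : involutive (@tau r).
Proof.
move=> i; apply: val_inj; rewrite /= !val_tau.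
by have := ltn_ord i; do ?case: eqP => //; lia.
Qed.

Lemma linmap_ext r (A B : endo r) :
  (forall j, A *m alpha j = B *m alpha j) -> A = B.
Proof.
by move=> AB; apply/matrixP=> i j; have/colP/(_ i) := AB j; rewrite -!colE !mxE.
Qed.

Lemma cartanE r (i j : node r) : cartan i j =
  if i == j :> nat then 2
  else if [|| i == j.+1 :> nat, j == i.+1 :> nat,
              (i == 0 :> nat) && (j == r.*2 :> nat)
            | (j == 0 :> nat) && (i == r.*2 :> nat)] then -1 else 0.
Proof.
rewrite /cartan -(inj_eq val_inj) /=; case: ifP => // /negbT ij.
have hi := ltn_ord i; have hj := ltn_ord j.
have E (a b : node r) : (a == b.+1 %[mod r.*2.+1])%N =
   (a == b.+1 :> nat) || (a == 0 :> nat) && (b == r.*2 :> nat).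
  have ha := ltn_ord a; have hb := ltn_ord b.
  rewrite (modn_small ha); case: (ltngtP b r.*2) => h; last first.
  - by rewrite h modnn andbT; lia.
  - lia.
  - by rewrite modn_small // andbF orbF.
by rewrite !E; congr (if _ then _ else _); lia.
Qed.

Lemma cartan_tau r (i j : node r) : cartan (tau i) (tau j) = cartan i j.
Proof.
have hi := ltn_ord i; have hj := ltn_ord j; rewrite !cartanE !val_tau.
have I2 (a b c d : bool) (x y z : int) : a = c -> b = d ->
  (if a then x else if b then y else z) = if c then x else if d then y else z.
  by move=> -> ->.
by apply: I2; case: (eqVneq (i : nat) 0%N) => i0;
   case: (eqVneq (j : nat) 0%N) => j0; lia.
Qed.

Lemma tauM_refl r (i : node r) : tauM r * refl i = refl (tau i) * tauM r.
Proof.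
apply: linmap_ext => j; rewrite -!mulmxA refl_alpha tauM_alpha refl_alpha.
by rewrite mulmxBr -scalemxAr !tauM_alpha cartan_tau.
Qed.

Lemma refl_invol r (i : node r) : refl i * refl i = 1.
Proof.
apply: linmap_ext => j; rewrite -mulmxA !refl_alpha mulmxBr -scalemxAr.
rewrite !refl_alpha mul1mx /cartan eqxx.
by apply/colP=> k; rewrite !mxE; ring.
Qed.

Lemma pairing_fund r (i j : node r) : i != 0 ->
  pairing (fund_weight i) (alpha j) = if j == 0 then -1 else (j == i)%:R.
Proof.
move=> i0; rewrite /pairing -colE !mxE; case: (eqVneq j 0) => [->|_].
  by rewrite eq_sym (negbTE i0) sub0r.
by rewrite subr0.
Qed.

Lemma transl_fund_delta r (i : node r) :
  transl (fund_weight i) *m delta r = delta r.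
Proof.
rewrite {1}/delta mulmx_sumr.
under eq_bigr do rewrite linmap_alpha.
rewrite sumrB -scaler_suml.
suff -> : \sum_(j < r.*2.+1) pairing (fund_weight i) (alpha j) = 0.
  by rewrite scale0r subr0.
under eq_bigr do rewrite /pairing -colE !mxE.
have E (a : node r) : \sum_(j < r.*2.+1) (j == a)%:R = 1 :> int.
  by rewrite (bigD1 a) //= eqxx big1 ?addr0 // => j /negbTE ->.
by rewrite sumrB !E subrr.
Qed.

Lemma varpi0 r : varpi (0 : node r) = 1.
Proof.
have T : transl (fund_weight (0 : node r)) = 1.
  apply: linmap_ext => j; rewrite linmap_alpha mul1mx /pairing -colE !mxE.
  by rewrite subrr scale0r subr0.
by rewrite /varpi /tau eqxx T mulr1.
Qed.

Lemma refl_comm r (a b : node r) : cartan a b = 0 -> cartan b a = 0 ->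
  refl a * refl b = refl b * refl a.
Proof.
move=> ab ba; apply: linmap_ext => j; rewrite -!mulmxA !refl_alpha.
rewrite !mulmxBr -!scalemxAr !refl_alpha ab ba.
by apply/colP=> k; rewrite !mxE; ring.
Qed.

Lemma refl_braid r (a b : node r) : cartan a b = -1 -> cartan b a = -1 ->
  refl a * refl b * refl a = refl b * refl a * refl b.
Proof.
move=> ab ba; have E (c : node r) : cartan c c = 2 by rewrite /cartan eqxx.
apply: linmap_ext => j; rewrite -!mulmxA.
do 3![rewrite ?mulmxBr -?scalemxAr ?refl_alpha ?ab ?ba ?E].
by apply/colP=> k; rewrite !mxE; ring.
Qed.

Lemma rgen_Wtau r (i : 'I_r.+1) : (0 < r)%N -> inWtau (rgen i).
Proof.
move=> hr; have hi := ltn_ord i; rewrite /rgen; case: eqP => i0; [|case: eqP => ir].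
- split; first by exists [:: 0]; rewrite big_seq1.
  by rewrite tauM_refl /tau eqxx.
- split; first by exists [:: inord r; inord r.+1; inord r];
    rewrite !big_cons big_nil mulr1 mulrA.
  have vr : (inord r : node r) = r :> nat by rewrite inordK //; lia.
  have vs : (inord r.+1 : node r) = r.+1 :> nat by rewrite inordK //; lia.
  have tr : tau (inord r : node r) = inord r.+1.
    by apply: ord_inj; rewrite val_tau vr vs; case: eqP; lia.
  have ts : tau (inord r.+1 : node r) = inord r by rewrite -tr tauK.
  rewrite !mulrA tauM_refl tr -(mulrA (refl _)) tauM_refl ts mulrA.
  rewrite -(mulrA (_ * _) _ (refl _)) tauM_refl tr mulrA.
  by rewrite refl_braid // cartanE vr vs ifF ?ifT //; lia.
- split; first by exists [:: inord i; tau (inord i)];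
    rewrite !big_cons big_nil mulr1.
  have vi : (inord i : node r) = i :> nat by rewrite inordK //; lia.
  rewrite mulrA tauM_refl -(mulrA (refl _)) tauM_refl tauK mulrA.
  by rewrite refl_comm // cartanE val_tau vi !ifF //; lia.
Qed.

(* Main.v *)
(* W_tau acts on the affine root lattice as the group of affine signed
   permutations (affine type C_r): if the nodes are the steps along a periodic
   line of positions, based at the position that W_tau fixes, then each
   r_i permutes the positions, and varpi_k is the translation by one period of k
   positions and of their mirror images in the opposite direction.  The word of
   varpi_k is the k-th power of the k-cycle that ends in a jump by a period.
   For the lower bound, the number of reflection hyperplanes separating an
   alcove from the fundamental one grows by at most 1 under each generator, and
   it is k(2r+1-k) for varpi_k. *)
Require Import Defs.
From mathcomp Require Import all_boot all_order all_algebra.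
From mathcomp Require Import ring zify.

Set Implicit Arguments.
Unset Strict Implicit.
Unset Printing Implicit Defensive.

Import Order.TTheory GRing.Theory Num.Theory.
Local Open Scope ring_scope.

Ltac split_if := repeat (match goal with
  | |- context [if ?b then _ else _] =>
      lazymatch b with
      | context [if _ then _ else _] => fail
      | _ => case: (boolP b) => /= ?
      end
  end; try lia); try lia; try by congr (_, _); lia.

(** * The generators as permutations of positions *)

Definition col_of_fun r (g : nat -> int) : lattice r := \col_j g j.

Definition refl_fun r (i : nat) (g : nat -> int) (j : nat) : int :=
  if j == i then
    g (if i == r.*2 then 0 else i.+1)%N + g (if i == 0 then r.*2 else i.-1)%N - g i
  else g j.

Lemma eq_col_of_fun r (g h : nat -> int) :
  (forall j, (j < r.*2.+1)%N -> g j = h j) -> col_of_fun r g = col_of_fun r h.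
Proof. by move=> gh; apply/colP=> j; rewrite !mxE gh. Qed.

(** As 2r+1 is at least 3, a node and its two neighbours are distinct, and they carry all the
    nonzero entries of its Cartan row. *)
Lemma refl_col_of_fun r (i : node r) (g : nat -> int) : (0 < r)%N ->
  refl i *m col_of_fun r g = col_of_fun r (refl_fun r i g).
Proof.
move=> hr; have hi := ltn_ord i.
have -> : refl i *m col_of_fun r g =
    col_of_fun r g - (\sum_j cartan i j * g j) *: alpha i.
  apply/colP=> l; rewrite !mxE mulr_suml.
  under eq_bigr => j _ do rewrite !mxE mulrBl mulrAC.
  rewrite sumrB; congr (_ - _).
  rewrite (bigD1 l) //= !eqxx mul1r big1 ?addr0 // => j jl.
  by rewrite eq_sym (negbTE jl) mul0r.
have ltS : ((if i == r.*2 :> nat then 0 else i.+1) < r.*2.+1)%N by case: eqP; lia.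
have ltP : ((if i == 0 :> nat then r.*2 else i.-1) < r.*2.+1)%N by case: eqP; lia.
pose s := Ordinal ltS; pose p := Ordinal ltP.
have E : \sum_j cartan i j * g j = g i *+ 2 - g s - g p.
  rewrite (bigD1 i) //= (bigD1 s) /=; last first.
    by rewrite -val_eqE /=; split_if.
  rewrite (bigD1 p) /=; last first.
    rewrite -!val_eqE /=.
    by case: (eqVneq (i : nat) 0%N) => ?; case: (eqVneq (i : nat) r.*2) => ?; lia.
  rewrite big1 => [|j]; last first.
    rewrite -!val_eqE /= => /andP[/andP[ji js] jp].
    have hj := ltn_ord j.
    have -> : cartan i j = 0 by rewrite cartanE; move: js jp; split_if.
    by rewrite mul0r.
  have -> : cartan i i = 2 by rewrite /cartan eqxx.
  have -> : cartan i s = -1 by rewrite cartanE /=; split_if.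
  have -> : cartan i p = -1 by rewrite cartanE /=; split_if.
  by rewrite addr0 /=; ring.
rewrite E; apply/colP=> l; rewrite !mxE /refl_fun andbT -val_eqE /=.
by case: (eqVneq (l : nat) i) => [->|_] /=; ring.
Qed.

(* The node [j] is the step from position [npos r j] to the next one, and
   [(b, q)] is position [b] (in 0..2r) of the [q]-th period; position 0, between
   the nodes [r] and [r.+1], is the one fixed by [W_tau]. *)
Definition npos r (j : nat) : nat := if (j <= r)%N then (j + r)%N else (j - r.+1)%N.

(** Coefficients of the vector from position 0 of period 0 to [p]: one [delta] per full period, plus
    the simple root of each further step passed. *)
Definition pt_coord r (p : nat * int) (j : nat) : int :=
  p.2 + (npos r j < p.1)%N%:Z.

Definition pt_vec r (p : nat * int) : lattice r := col_of_fun r (pt_coord r p).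

Definition act r (i : nat) (p : nat * int) : nat * int :=
  let: (b, q) := p in
  if i == r then
    if b == r.*2 then (1%N, q + 1) else if b == 1%N then (r.*2, q - 1) else (b, q)
  else if b == (r + i)%N then ((r + i).+1, q)
  else if b == (r + i).+1 then ((r + i)%N, q)
  else if b == (r - i)%N then ((r - i).+1, q)
  else if b == (r - i).+1 then ((r - i)%N, q)
  else (b, q).

(** The reflections in the nodes r and r+1 would have to move position 0, whose vector is 0. Their
    product in [rgen] fixes it and is treated separately. *)
Lemma refl_pt_vec r (i : node r) b q : (0 < r)%N -> (b <= r.*2)%N ->
  i != r :> nat -> i != r.+1 :> nat ->
  refl i *m pt_vec r (b, q) =
    pt_vec r (if b == npos r i then (npos r i).+1
              else if b == (npos r i).+1 then npos r i else b, q).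
Proof.
move=> hr hb ir ir1; have hi := ltn_ord i.
rewrite /pt_vec refl_col_of_fun //; apply: eq_col_of_fun => j hj.
rewrite /refl_fun; case: eqP => [->|ji]; rewrite /pt_coord /npos /=; last by split_if.
split_if.
Qed.

Lemma rgen_pt_vec r (i : 'I_r.+1) p : (0 < r)%N -> (p.1 <= r.*2)%N ->
  rgen i *m pt_vec r p = pt_vec r (act r i p).
Proof.
case: p => b q hr /= hb; have hi := ltn_ord i; rewrite /rgen.
case: eqP => i0.
  by rewrite refl_pt_vec //=; [congr (pt_vec _ _); rewrite /npos; split_if | lia].
case: eqP => ir.
  have vr : (inord r : node r) = r :> nat by rewrite inordK //; lia.
  have vs : (inord r.+1 : node r) = r.+1 :> nat by rewrite inordK //; lia.
  rewrite /pt_vec -!mulmxA !refl_col_of_fun // vr vs; apply: eq_col_of_fun => j hj.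
  rewrite /refl_fun /pt_coord /npos.
  case: (eqVneq j r) => [->|jr]; first by split_if.
  case: (eqVneq j r.+1) => [->|jr1]; first by split_if.
  split_if.
have vi : (inord i : node r) = i :> nat by rewrite inordK //; lia.
have vt : tau (inord i : node r) = (r.*2.+1 - i)%N :> nat.
  by rewrite val_tau vi; case: eqP.
rewrite -mulmxA refl_pt_vec ?vt; try lia.
by rewrite refl_pt_vec ?vi; [congr (pt_vec _ _) | ..]; rewrite /npos; split_if.
Qed.

Lemma act_le r i p : (0 < r)%N -> (i <= r)%N -> (p.1 <= r.*2)%N ->
  ((act r i p).1 <= r.*2)%N.
Proof. by case: p => b q /= hr ir hb; split_if. Qed.

Lemma foldr_act_le r u p : (0 < r)%N -> all (leq^~ r) u -> (p.1 <= r.*2)%N ->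
  ((foldr (act r) p u).1 <= r.*2)%N.
Proof.
by move=> hr + hp; elim: u => //= i u IH /andP[ir /IH]; apply: act_le.
Qed.

Lemma all_val_ord r (u : seq 'I_r.+1) : all (leq^~ r) [seq val i | i <- u].
Proof. by apply/allP=> _ /mapP[i _ ->]; rewrite -ltnS ltn_ord. Qed.

(** The rightmost letter acts first, hence [foldr]. *)
Lemma evalw_pt_vec r (u : seq 'I_r.+1) p : (0 < r)%N -> (p.1 <= r.*2)%N ->
  evalw u *m pt_vec r p = pt_vec r (foldr (act r) p [seq val i | i <- u]).
Proof.
move=> hr hp; rewrite /evalw; elim: u => [|i u IH].
  by rewrite big_nil mul1mx.
rewrite big_cons -mulmxA IH rgen_pt_vec //.
exact: foldr_act_le hr (all_val_ord u) hp.
Qed.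

Lemma alpha_pt_vec r (j : node r) : alpha j =
  (if npos r j == r.*2 then pt_vec r (0%N, 1) else pt_vec r ((npos r j).+1, 0))
    - pt_vec r (npos r j, 0).
Proof.
have hj := ltn_ord j; apply/colP=> l; have hl := ltn_ord l.
rewrite !mxE andbT -val_eqE /=.
case: (eqVneq (npos r j) r.*2) => nj; rewrite !mxE /pt_coord /=.
  by move: nj; rewrite /npos; split_if.
by move: nj; rewrite /npos; split_if.
Qed.

(** Position vectors suffice because each simple root is the difference of two consecutive ones. *)
Lemma pt_vec_ext r (A B : endo r) :
  (forall p, (p.1 <= r.*2)%N -> A *m pt_vec r p = B *m pt_vec r p) -> A = B.
Proof.
move=> AB; apply: linmap_ext => j; rewrite alpha_pt_vec !mulmxBr.
have hj := ltn_ord j.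
have hn : (npos r j <= r.*2)%N by rewrite /npos; split_if.
by case: eqP => nj; rewrite !AB //= ltn_neqAle hn andbT; apply/eqP.
Qed.

Lemma pt_vec_inj r p p' : (p.1 <= r.*2)%N -> (p'.1 <= r.*2)%N ->
  pt_vec r p = pt_vec r p' -> p = p'.
Proof.
case: p p' => b q [b' q'] /= hb hb' /colP E.
have C j : (j < r.*2.+1)%N -> pt_coord r (b, q) j = pt_coord r (b', q') j.
  by move=> hj; have := E (Ordinal hj); rewrite !mxE.
have node_at c : (c <= r.*2)%N ->
    exists2 j, (j < r.*2.+1)%N & npos r j = c.
  move=> hc; exists (if (r <= c)%N then c - r else c + r.+1)%N; first by split_if.
  by rewrite /npos; split_if.
have {}C c : (c <= r.*2)%N -> q + (c < b)%N%:Z = q' + (c < b')%N%:Z.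
  by move=> /node_at[j hj <-]; apply: C.
(* Step 2r lies beyond neither position, so it gives [q = q']; the steps at [b] and [b'] then give
   both inequalities between [b] and [b']. *)
have := C _ (leqnn _); have := C _ hb; have := C _ hb'.
by move=> *; congr (_, _); lia.
Qed.

(** * The translations on positions *)

Lemma transl_fund_col_of_fun r (a : node r) (g : nat -> int) :
  transl (fund_weight a) *m col_of_fun r g = col_of_fun r (fun j => g j - (g a - g 0%N)).
Proof.
have dE (i : node r) : delta r i 0 = 1.
  rewrite /delta summxE (bigD1 i) //= big1 ?addr0; last first.
    by move=> j ji; rewrite mxE eq_sym (negbTE ji).
  by rewrite mxE !eqxx.
have S (i : node r) : \sum_(j < r.*2.+1) (j == i)%:R * g j = g i.
  rewrite (bigD1 i) //= eqxx mul1r big1 ?addr0 // => j ji.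
  by rewrite (negbTE ji) mul0r.
apply/colP=> i; rewrite !mxE.
under eq_bigr => j _ do
  rewrite !mxE /pairing -colE !mxE dE mulr1 andbT (eq_sym i) !mulrBl.
by rewrite !sumrB !S.
Qed.

Definition shift r k (p : nat * int) : nat * int :=
  (p.1, p.2 + (r < p.1 <= r + k)%N%:Z - (r - k < p.1 <= r)%N%:Z).

(** The nodes 0, k and [tau] k are the steps from r, r+k and r-k, so the two pairings are, up to
    sign, the indicators of the two intervals in [shift]. *)
Lemma varpi_pt_vec r k p : (k <= r)%N -> (p.1 <= r.*2)%N ->
  varpi (inord k : node r) *m pt_vec r p = pt_vec r (shift r k p).
Proof.
move=> hk hp; have vk : (inord k : node r) = k :> nat by rewrite inordK //; lia.
rewrite -mulmxA !transl_fund_col_of_fun; apply: eq_col_of_fun => j hj.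
by rewrite val_tau vk /pt_coord /npos /shift /=; split_if.
Qed.

(** * The words as cycles *)

Lemma foldr_act_asc r m l b q : (0 < m)%N -> (m + l <= r)%N ->
  foldr (act r) (b, q) (iota m l) =
  (if b == r + m + l then r + m
   else if r + m <= b < r + m + l then b.+1
   else if b == (r - m - l).+1 then (r - m).+1
   else if (r - m - l).+1 < b <= (r - m).+1 then b.-1
   else b, q)%N.
Proof.
elim: l m => [|l IH] m hm hml; first by split_if.
by rewrite /= IH; try lia; rewrite /act; split_if.
Qed.

Lemma foldr_act_desc r m l b q : (0 < m)%N -> (m + l <= r)%N ->
  foldr (act r) (b, q) (rev (iota m l)) =
  (if b == r + m then r + m + l
   else if r + m < b <= r + m + l then b.-1
   else if b == (r - m).+1 then (r - m - l).+1
   else if (r - m - l).+1 <= b < (r - m).+1 then b.+1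
   else b, q)%N.
Proof.
elim: l m b q => [|l IH] m b q hm hml; first by rewrite /rev /=; split_if.
rewrite /= rev_cons foldr_rcons [act r m _]/act.
by split_if; rewrite IH; try lia; split_if.
Qed.

Definition cycle_word r k : seq nat := iota 0 r.+1 ++ rev (iota k (r - k)).

(** The descending run lowers the positions above r+k and the ascending run raises them back.
    Position r+k itself is carried to 2r, across the period boundary by letter r, and on to r+1. *)
Lemma foldr_act_cycle r k b q : (0 < k <= r)%N -> (b <= r.*2)%N ->
  foldr (act r) (b, q) (cycle_word r k) =
  if b == (r + k)%N then (r.+1, q + 1)
  else if b == (r - k).+1 then (r, q - 1)
  else (if r < b < r + k then b.+1
        else if (r - k).+1 < b <= r then b.-1 else b, q)%N.
Proof.
move=> hk hb; have hkr : (k + (r - k) <= r)%N by lia.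
have hr : (0 < r)%N by lia.
(* Letters 0 and r are split off: the formulas for runs cover letters 1 to r-1. *)
have wE : iota 0 r.+1 = 0%N :: iota 1 r.-1 ++ [:: r].
  have -> : r.+1 = (1 + r.-1 + 1)%N by lia.
  by rewrite !iotaD /= add0n add1n prednK.
have dE : foldr (act r) (b, q) ([:: r] ++ rev (iota k (r - k))) =
    if b == (r + k)%N then (1%N, q + 1)
    else if b == (r - k).+1 then (r.*2, q - 1)
    else (if r + k < b then b.-1 else if 0 < b <= r - k then b.+1 else b, q)%N.
  by rewrite foldr_cat foldr_act_desc; try lia; rewrite /= eqxx; split_if.
have aE b' q' : (b' <= r.*2)%N ->
    foldr (act r) (b', q') (0%N :: iota 1 r.-1) =
    ((if b' == r.*2 then r else if r < b' < r.*2 then b'.+1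
     else if b' == 1 then r.+1 else if 1 < b' <= r then b'.-1
     else b')%N, q').
  by move=> hb'; rewrite /= foldr_act_asc; try lia; rewrite /act; split_if.
rewrite /cycle_word wE -cat_cons -catA foldr_cat dE.
move: (_ :: iota 1 r.-1) aE => w aE.
split_if; rewrite aE; try lia; split_if.
Qed.

Lemma all_cycle_word r k : (k <= r)%N -> all (leq^~ r) (cycle_word r k).
Proof.
move=> hk; rewrite all_cat all_rev; apply/andP; split; apply/allP=> i;
  rewrite mem_iota; lia.
Qed.

Lemma size_cycle_word r k : (k <= r)%N -> size (cycle_word r k) = (r.*2.+1 - k)%N.
Proof. by move=> hk; rewrite size_cat size_rev !size_iota; lia. Qed.

(** Up to the k-th power each position wraps at most once; at t = k each has wrapped exactly once,
    which is [shift]. *)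
Lemma foldr_act_cycles r k t b q : (0 < k <= r)%N -> (b <= r.*2)%N -> (t <= k)%N ->
  foldr (act r) (b, q) (flatten (nseq t (cycle_word r k))) =
  if (r < b <= r + k)%N then
    if (b + t <= r + k)%N then ((b + t)%N, q) else ((b + t - k)%N, q + 1)
  else if (r - k < b <= r)%N then
    if (r - k + t < b)%N then ((b - t)%N, q) else ((b + k - t)%N, q - 1)
  else (b, q).
Proof.
move=> hk hb; have wE b' q' := @foldr_act_cycle r k b' q' hk.
move: (cycle_word r k) wE => w wE.
elim: t => [_|t IH ht]; first by rewrite /= addn0 subn0; split_if.
rewrite /= foldr_cat IH; last by lia.
by split_if; rewrite wE; try lia; split_if.
Qed.

Lemma foldr_act_cycles_shift r k p : (0 < k <= r)%N -> (p.1 <= r.*2)%N ->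
  foldr (act r) p (flatten (nseq k (cycle_word r k))) = shift r k p.
Proof.
case: p => b q hk /= hb; rewrite foldr_act_cycles // /shift /=.
by split_if.
Qed.

(** The word 1, ..., r-1 is the same r-cycle as the Coxeter word but without the period jump. In the
    r-fold composite only position 2r wraps during that first factor, so it alone (with its mirror)
    is not shifted. *)
Lemma foldr_act_coxeter_shift r p : (0 < r)%N -> (p.1 <= r.*2)%N ->
  foldr (act r) p (flatten (nseq r.-1 (iota 0 r.+1)) ++ iota 1 r.-1) =
  shift r r.-1 p.
Proof.
case: p => b q hr hb; rewrite /fst in hb.
have -> : iota 0 r.+1 = cycle_word r r by rewrite /cycle_word subnn /rev /= cats0.
rewrite foldr_cat foldr_act_asc; try lia.
rewrite foldr_act_cycles /shift /=; try lia; split_if.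
Qed.

(** * Separating walls and their growth under a generator *)

(* For the alcove of [f], [wall1] counts the hyperplanes
   [x_i = c] (with [2c] integral) and [wall2] the hyperplanes [x_i - x_j = c]
   and [x_i + x_j = c] (with [c] integral) separating it from the fundamental
   one. *)
Definition wall1 r (p : nat * int) : nat :=
  `|p.2 *+ 2 - (p.1 <= r)%N%:Z|%N.

Definition wall2 r (p p' : nat * int) : nat :=
  (`|(p'.2 - p.2 - (p'.1 < p.1)%N%:Z)%R|
   + `|(p.2 + p'.2 - (p.1 + p'.1 <= r.*2)%N%:Z)%R|)%N.

Definition walls r (f : 'I_r -> nat * int) : nat :=
  (\sum_(i < r) wall1 r (f i) + \sum_(i < r) \sum_(j < r | i < j) wall2 r (f i) (f j))%N.

(* [f i] is the image of position [r + 1 + i]; positions [b] and [2r + 1 - b]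
   mirror each other, so the images meet each mirror pair at most once. *)
Definition free_pt r (p : nat * int) : bool := (0 < p.1 <= r.*2)%N.

Definition indep r (p p' : nat * int) : bool :=
  (p.1 != p'.1) && (p.1 + p'.1 != r.*2.+1)%N.

Definition general_position r (f : 'I_r -> nat * int) : Prop :=
  (forall i, free_pt r (f i)) /\ (forall i j, i != j -> indep r (f i) (f j)).

(** Level c is a mirror pair. For 0 < i < r letter i exchanges levels i and i+1; letter 0 flips
    level 1 and letter r flips level r. *)
Definition at_level r c (p : nat * int) : bool :=
  (p.1 == r + c)%N || (p.1 == (r - c).+1)%N.

Lemma free_pt_act r i p : (i <= r)%N -> free_pt r p -> free_pt r (act r i p).
Proof. by case: p => b q; rewrite /free_pt /= => hi hb; split_if. Qed.

Lemma indep_act r i p p' : (i <= r)%N -> free_pt r p -> free_pt r p' ->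
  indep r p p' -> indep r (act r i p) (act r i p').
Proof.
by case: p p' => b q [b' q']; rewrite /free_pt /indep /= => hi hb hb' h; split_if.
Qed.

Lemma general_position_act r i (f : 'I_r -> nat * int) : (i <= r)%N ->
  general_position f -> general_position (act r i \o f).
Proof.
move=> hi [f0 f1]; split=> [j|j l jl]; first exact: free_pt_act.
exact: indep_act (f1 _ _ jl).
Qed.

Lemma wall1_act r i p : (i <= r)%N -> free_pt r p ->
  (wall1 r (act r i p) <=
   wall1 r p + (((i == 0) || (i == r)) && at_level r (maxn i 1) p))%N.
Proof.
by case: p => b q; rewrite /free_pt /wall1 /at_level /= => hi hb; split_if.
Qed.

Definition swap_level r i (b : nat) : nat :=
  (if b == r + i then (r + i).+1 else if b == (r + i).+1 then r + i
   else if b == r - i then (r - i).+1 else if b == (r - i).+1 then r - i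
   else b)%N.

(** At most one of the two comparisons entering [wall2] can change, and only if the points occupy
    levels i and i+1. *)
Lemma swap_level_order r i b b' : (0 < i < r)%N ->
  (b != b') && (b + b' != r.*2.+1)%N ->
  let special := at_level r i (b, 0) && at_level r i.+1 (b', 0)
                 || at_level r i.+1 (b, 0) && at_level r i (b', 0) in
  let c := swap_level r i b in let c' := swap_level r i b' in
  ((c' < c) = (b' < b) \/ special && ((c + c' <= r.*2) == (b + b' <= r.*2)))%N /\
  ((c + c' <= r.*2) = (b + b' <= r.*2) \/ special)%N.
Proof.
move=> hi hb special; rewrite /special /at_level /swap_level /=.
by split_if; split; lia.
Qed.

Lemma wall2_act r i p p' : (i <= r)%N -> free_pt r p -> free_pt r p' ->
  indep r p p' ->
  (wall2 r (act r i p) (act r i p') <= wall2 r p p' +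
    ((0 < i < r) && (at_level r i p && at_level r i.+1 p'
                     || at_level r i.+1 p && at_level r i p')))%N.
Proof.
case: p p' => b q [b' q'] hi hb hb' h.
have [hir|hir] := boolP (0 < i < r)%N.
  have actE c x : act r i (c, x) = (swap_level r i c, x).
    by rewrite /act /swap_level; split_if.
  rewrite !actE /wall2 /=.
  have := swap_level_order hir h.
  move: (swap_level r i b) (swap_level r i b') => c c' /=.
  rewrite -[at_level r i (b, 0)]/(at_level r i (b, q)).
  rewrite -[at_level r i.+1 (b, 0)]/(at_level r i.+1 (b, q)).
  rewrite -[at_level r i (b', 0)]/(at_level r i (b', q')).
  rewrite -[at_level r i.+1 (b', 0)]/(at_level r i.+1 (b', q')).
  move: (_ || _) => special [[E|/andP[-> /eqP E]] H]; last by rewrite E; lia.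
  by case: H => [F|->]; rewrite E ?F ?leq_addr //; lia.
(* For i = 0 no comparison changes; for i = r the change of period of the moved point compensates
   the changed comparisons in both terms. *)
rewrite addn0; move: hb hb' h; rewrite /free_pt /indep /wall2 /= => hb hb' h.
have {hir hi}[->|[i0 ->]] : i = 0%N \/ r != 0%N /\ i = r by lia.
  rewrite addn0 subn0; case: (0%N =P r) => [|_]; first by lia.
  by split_if.
rewrite eqxx.
by split_if.
Qed.

Lemma sum_pred_le1 (T : finType) (P : pred T) :
  (forall x y, P x -> P y -> x = y) -> (\sum_x P x <= 1)%N.
Proof.
move=> Pinj; rewrite -big_mkcond sum1_card; apply/card_le1_eqP => x y Px Py.
exact: Pinj.
Qed.

Lemma at_level_inj r c c' (f : 'I_r -> nat * int) i j :
  (0 < c <= r)%N -> (0 < c' <= r)%N -> general_position f ->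
  at_level r c (f i) -> at_level r c' (f j) -> (i == j) = (c == c').
Proof.
move=> hc hc' [_ f1]; case: (eqVneq i j) => [->|/f1]; rewrite /at_level /indep; lia.
Qed.

(** Each level has at most one occupant, so at most one index, or one pair of indices, can
    contribute an extra wall. *)
Lemma walls_act r i (f : 'I_r -> nat * int) : (i <= r)%N -> general_position f ->
  (walls (act r i \o f) <= (walls f).+1)%N.
Proof.
move=> hi fP; have [f0 f1] := fP.
pose e1 j := ((i == 0) || (i == r)) && at_level r (maxn i 1) (f j).
pose special j l := at_level r i (f j) && at_level r i.+1 (f l)
                    || at_level r i.+1 (f j) && at_level r i (f l).
pose e2 j l := (0 < i < r)%N && special j l.
have -> : (walls f).+1 = (walls f + 1)%N by rewrite addn1.
apply: leq_trans (_ : _ <= walls f + (\sum_(j < r) e1 j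
   + \sum_(x : 'I_r * 'I_r) ((x.1 < x.2) && e2 x.1 x.2)))%N _.
  rewrite /walls addnACA; apply: leq_add.
    by rewrite -big_split; apply: leq_sum => j _; apply: wall1_act.
  have -> : (\sum_(x : 'I_r * 'I_r) ((x.1 < x.2) && e2 x.1 x.2) =
             \sum_(j < r) \sum_(l < r | j < l) e2 j l)%N.
    rewrite pair_big_dep /= [RHS]big_mkcond /=.
    by apply: eq_bigr => x _; case: ifP.
  rewrite -big_split /=; apply: leq_sum => j _; rewrite -big_split /=.
  apply: leq_sum => l jl; apply: wall2_act => //.
  by apply: f1; rewrite neq_ltn jl.
rewrite leq_add2l; have [hir|hir] := boolP (0 < i < r)%N.
  rewrite big1 ?add0n => [|j _]; last by rewrite /e1; case: eqP => ?; case: eqP => ?; lia.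
  apply: sum_pred_le1 => -[j l] [j' l'] /andP[/= jl].
  rewrite /e2 hir /= => s /andP[/= jl'] s'.
  have hi1 : (0 < i <= r)%N by lia.
  have hi2 : (0 < i.+1 <= r)%N by lia.
  have inj c x y : (0 < c <= r)%N -> at_level r c (f x) -> at_level r c (f y) -> x = y.
    by move=> hc fx fy; apply/eqP; rewrite (at_level_inj hc hc fP fx fy).
  (* In the two mixed cases the orders [j < l] and [j' < l'] contradict each other. *)
  case/orP: s => /andP[s1 s2]; case/orP: s' => /andP[s1' s2'].
  - by rewrite (inj _ _ _ hi1 s1 s1') (inj _ _ _ hi2 s2 s2').
  - by move: jl jl'; rewrite (inj _ _ _ hi1 s1 s2') (inj _ _ _ hi2 s2 s1'); lia.
  - by move: jl jl'; rewrite (inj _ _ _ hi2 s1 s2') (inj _ _ _ hi1 s2 s1'); lia.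
  - by rewrite (inj _ _ _ hi1 s2 s2') (inj _ _ _ hi2 s1 s1').
rewrite addnC big1 ?add0n => [|x _]; last by rewrite /e2 (negbTE hir) andbF.
apply: sum_pred_le1 => j l /andP[_ s] /andP[h s']; apply/eqP.
have hc : (0 < maxn i 1 <= r)%N by have := ltn_ord j; lia.
by rewrite (at_level_inj hc hc fP s s').
Qed.

(** * The lower bound for the length *)

Definition origin r (i : 'I_r) : nat * int := ((r + i).+1, 0).

Lemma general_position_origin r : general_position (@origin r).
Proof.
split=> [i|i j]; rewrite /free_pt /indep /=; first by have := ltn_ord i; lia.
by rewrite -val_eqE /=; lia.
Qed.

Lemma walls_foldr r (u : seq nat) : all (leq^~ r) u ->
  (walls (fun i : 'I_r => foldr (act r) (origin i) u) <= size u)%N /\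
  general_position (fun i : 'I_r => foldr (act r) (origin i) u).
Proof.
elim: u => [_|i u IH /andP[hi /IH[le_u gp]]] /=.
  split; last exact: general_position_origin.
  rewrite /walls !big1 // => i _; last by rewrite /wall1 /=; lia.
  by rewrite big1 // => j ij; rewrite /wall2 /=; lia.
split; last exact: general_position_act gp.
exact: leq_trans (walls_act hi gp) _.
Qed.

Lemma sum_above n i : (\sum_(j < n | i < j) 1 = n - i.+1)%N.
Proof.
elim: n => [|n IH]; first by rewrite big_ord0.
by rewrite big_mkcond big_ord_recr /= -big_mkcond IH; case: ltnP; lia.
Qed.

(** For i < k, [wall1] is 2 and each j > i adds 2: as 0+2 if j is shifted as well, as 1+1 if not. So
    i contributes 2(r-i). *)
Lemma walls_shift r k : (k <= r)%N ->
  walls (fun i : 'I_r => shift r k (origin i)) = (k * (r.*2.+1 - k))%N.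
Proof.
move=> hk; have w1 (i : 'I_r) : wall1 r (shift r k (origin i)) = ((i < k) * 2)%N.
  by have := ltn_ord i; rewrite /wall1 /shift /=; lia.
have w2 (i j : 'I_r) : (i < j)%N ->
    wall2 r (shift r k (origin i)) (shift r k (origin j)) = ((i < k) * 2)%N.
  by have := ltn_ord j; rewrite /wall2 /shift /=; lia.
rewrite /walls -big_split /=.
transitivity (\sum_(i < r) (i < k) * 2 * (r - i))%N.
  apply: eq_bigr => i _; rewrite w1 (eq_bigr _ (w2 i)).
  under eq_bigr do rewrite -[((_ < _) * 2)%N]muln1.
  rewrite -big_distrr /= sum_above; have := ltn_ord i.
  by move=> hi; rewrite -mulnS; congr (_ * _)%N; lia.
(* The [minn] lets the induction run past the last nonzero term. *)
have S m : (m <= r)%N -> (\sum_(i < m) (i < k) * 2 * (r - i) =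
    minn m k * (r.*2.+1 - minn m k))%N.
  elim: m => [_|m IH hm]; first by rewrite big_ord0; lia.
  rewrite big_ord_recr /= IH; last by lia.
  have [mk|mk] := boolP (m < k)%N; last first.
    have [-> ->] : minn m k = k /\ minn m.+1 k = k by lia.
    by rewrite addn0.
  have [-> ->] : minn m k = m /\ minn m.+1 k = m.+1 by lia.
  have -> : (r.*2.+1 - m = (r.*2.+1 - m.+1).+1)%N by lia.
  by rewrite mulnS mulSn; lia.
by rewrite S // (minn_idPr hk).
Qed.

Lemma inWtau_evalw r (u : seq 'I_r.+1) : (0 < r)%N -> inWtau (evalw u).
Proof.
move=> hr; rewrite /evalw; elim: u => [|i u [[v vE] uC]].
  by rewrite big_nil; split; [exists [::]; rewrite big_nil | rewrite mulr1 mul1r].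
rewrite big_cons; have [[w wE] iC] := rgen_Wtau i hr.
split; first by exists (w ++ v); rewrite big_cat /= -wE -vE.
by rewrite mulrA iC -mulrA uC mulrA.
Qed.

(** Position vectors are distinct, so every word for the translation moves [origin] as [shift] does
    and yields the same wall count. *)
Lemma varpi_length_ge r k (u : seq 'I_r.+1) : (0 < r)%N -> (k <= r)%N ->
  evalw u = varpi (inord k : node r) -> (k * (r.*2.+1 - k) <= size u)%N.
Proof.
move=> hr hk uE; have hu := all_val_ord u.
have [le_u _] := walls_foldr hu; rewrite size_map in le_u.
rewrite -walls_shift //; apply: leq_trans le_u.
rewrite eq_leq //; rewrite /walls.
have E (i : 'I_r) : shift r k (origin i) =
    foldr (act r) (origin i) [seq val j | j <- u].
  have hi := ltn_ord i; have le_o : ((origin i).1 <= r.*2)%N by rewrite /=; lia.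
  apply: (@pt_vec_inj r) => //; first exact: foldr_act_le.
  by rewrite -evalw_pt_vec // uE varpi_pt_vec.
congr (_ + _)%N; apply: eq_bigr => i _; first by rewrite E.
by apply: eq_bigr => j _; rewrite !E.
Qed.

Lemma reduced_varpi r k (s : seq nat) : (0 < r)%N -> (k <= r)%N ->
  all (leq^~ r) s -> size s = (k * (r.*2.+1 - k))%N ->
  (forall p, (p.1 <= r.*2)%N -> foldr (act r) p s = shift r k p) ->
  reduced_expression [seq inord i | i <- s] (varpi (inord k : node r)).
Proof.
move=> hr hk s_le s_size sE.
have valK : [seq val i | i <- [seq (inord i : 'I_r.+1) | i <- s]] = s.
  rewrite -map_comp map_id_in // => i /(allP s_le) /= ir.
  by rewrite inordK.
have E : evalw [seq inord i | i <- s] = varpi (inord k : node r).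
  apply: pt_vec_ext => p hp.
  by rewrite evalw_pt_vec // valK sE // varpi_pt_vec.
split=> //; split; first by rewrite -E; apply: inWtau_evalw.
  by exists [seq inord i | i <- s].
by move=> u uE; rewrite size_map s_size; apply: varpi_length_ge.
Qed.

Lemma map_flatten_nseq (S T : Type) (f : S -> T) n (s : seq S) :
  flatten (nseq n [seq f x | x <- s]) = [seq f x | x <- flatten (nseq n s)].
Proof. by elim: n => //= n ->; rewrite map_cat. Qed.

Lemma size_flatten_nseq (T : Type) n (s : seq T) :
  size (flatten (nseq n s)) = (n * size s)%N.
Proof. by elim: n => //= n IH; rewrite size_cat IH mulSn. Qed.

Lemma all_flatten_nseq (T : Type) (a : pred T) n (s : seq T) :
  all a s -> all a (flatten (nseq n s)).
Proof. by move=> sa; elim: n => //= n IH; rewrite all_cat sa. Qed.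

Theorem corollary2p10 (r k : nat) (hr : (1 <= r)%N) (hk : (1 <= k <= r)%N) :
  [/\ reduced_expression
        (flatten (nseq k
          [seq inord i | i <- iota 0 r.+1 ++ rev (iota k (r - k))]))
        (@varpi r (inord k)),
      reduced_expression
        (flatten (nseq r.-1 [seq inord i | i <- iota 0 r.+1])
           ++ [seq inord i | i <- iota 1 r.-1])
        (@varpi r (inord r.-1))
    & has_length (@varpi r (inord k)) (k * (r.*2.+1 - k))%N].
Proof.
have kr : (k <= r)%N by case/andP: hk.
have redk : reduced_expression
    (flatten (nseq k [seq inord i | i <- cycle_word r k])) (@varpi r (inord k)).
  rewrite map_flatten_nseq; apply: reduced_varpi => //.
  - exact: all_flatten_nseq (all_cycle_word kr).
  - by rewrite size_flatten_nseq size_cycle_word.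
  - by move=> p; apply: foldr_act_cycles_shift.
split=> //.
- rewrite map_flatten_nseq -map_cat; apply: reduced_varpi => //.
  + by rewrite leq_pred.
  + rewrite all_cat all_flatten_nseq /=; apply/allP=> i; rewrite mem_iota; lia.
  (* The count is (r-1)(r+1) + (r-1) = (r-1)(r+2), which is k(2r+1-k) at k = r-1. *)
  + by rewrite size_cat size_flatten_nseq !size_iota; nia.
  + by move=> p; apply: foldr_act_coxeter_shift.
- case: redk => _; rewrite map_flatten_nseq size_map size_flatten_nseq.
  by rewrite size_cycle_word.
Qed.
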